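(* Let $F:[a,b]\times\mathbb R^d\to\mathbb R^d$ satisfy the following global Carathéodory--Lipschitz assumptions: (1) for every $x\in\mathbb R^d$, $t\mapsto F(t,x)$ is $\mu_g$-measurable; (2) for $\mu_g$-a.e. $t$, $x\mapsto F(t,x)$ is continuous; (3) there exist nonnegative $m,L\in L_g^1([a,b))$ such that $\|F(t,0)\|\le m(t)$ and $\|F(t,x)-F(t,y)\|\le L(t)\|x-y\|$ for $\mu_g$-a.e. $t$ and all $x,y\in\mathbb R^d$. Let $u\in L_g^1([a,b);\mathbb R^d)$ and $u_0,u_b\in\mathbb R^d$. Then the state $([u],u_0,u_b)$ is a global weak solution of $D_gU=F(t,U)$, $U(a)=u_0$, if and only if $[u]$ admits a representative $U\in AC_g([a,b];\mathbb R^d)$ (so $U=u$ $\mu_g$-a.e.) satisfying $$U(t)=u_0+\int_{[a,t)}F(s,U(s))\,d\mu_g(s),\qquad t\in[a,b],$$ and $U(b)=u_b$.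
   Context: Let $\mathbb F$ be $\mathbb R$ or $\mathbb C$, let $a<b$ be real, $d\in\mathbb N$, and let $g:[a,b]\to\mathbb R$ be nondecreasing and left-continuous. $\mu_g$ is the finite Lebesgue--Stieltjes measure on $[a,b)$ with $\mu_g([s,t))=g(t)-g(s)$ for $a\le s\le t\le b$. Standing assumption: $M_g:=\mu_g([a,b))=g(b)-g(a)>0$. For $1\le p\le\infty$, $L_g^p([a,b))$ is the $L^p$ space of $\mathbb F$-valued functions for the completion of $\mu_g$ (modulo $\mu_g$-a.e. equality); measurability is with respect to this completion; vector-valued spaces and integrals are understood componentwise. $J_g:=\{t\in[a,b):\Delta g(t):=g(t^+)-g(t)>0\}$ is the set of jump points. $AC_g([a,b])$ is the set of $u:[a,b]\to\mathbb F$ such that for every $\varepsilon>0$ there is $\delta>0$ such that, for every finite family of pairwise disjoint intervals $[a_j,b_j)\subset[a,b)$, $\sum_j(g(b_j)-g(a_j))<\delta$ implies $\sum_j|u(b_j)-u(a_j)|<\varepsilon$. It is known that $u\in AC_g([a,b])$ if and only if there is $v\in L_g^1([a,b))$ with $u(t)=u(a)+\int_{[a,t)}v\,d\mu_g$ for all $t\in[a,b]$; $v$ is unique $\mu_g$-a.e. and the Stieltjes derivative is $D_gu:=v$. $AC_g([a,b];\mathbb R^d)$ is understood componentwise. Posterior trace: $S_g\varphi(t):=\varphi(t^+)$ if $t\in J_g$ and $S_g\varphi(t):=\varphi(t)$ otherwise. Test space: $\mathcal T_g$ is the set of $\varphi:[a,b]\to\mathbb F$ of the form $\varphi(t)=c+\int_{[a,t)}\psi\,d\mu_g$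 with $c\in\mathbb F$, $\psi\in L_g^\infty([a,b))$ (so $D_g\varphi=\psi$). Global weak solution: a state $([u],u_0,u_b)$ with $u\in L_g^1([a,b);\mathbb R^d)$, $u_0,u_b\in\mathbb R^d$, such that $F(\cdot,u(\cdot))\in L_g^1$ and, for every $\varphi\in\mathcal T_g$ (componentwise identity), $$\int_{[a,b)}u\,D_g\varphi\,d\mu_g+\int_{[a,b)}F(t,u(t))\,S_g\varphi(t)\,d\mu_g(t)=u_b\varphi(b)-u_0\varphi(a).$$ *)

(* Defs.v *)
From HB Require Import structures.
From mathcomp Require Import all_boot all_order all_algebra.
From mathcomp Require Import complex ring lra.
From mathcomp Require Import all_classical all_reals all_analysis.

Set Implicit Arguments.
Unset Strict Implicit.
Unset Printing Implicit Defensive.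
Import Order.TTheory GRing.Theory Num.Theory.
Import numFieldNormedType.Exports.
Local Open Scope classical_set_scope.
Local Open Scope ring_scope.

(* Functions on [a, b] (or [a, b[) are represented by functions on R whose
   values outside that interval are never used. *)

Section integrator.
Context {R : realType}.

Record integrator (a b : R) := Integrator {
  integrator_fun :> R -> R ;
  integrator_nd : forall s t, a <= s -> s <= t -> t <= b ->
    integrator_fun s <= integrator_fun t ;
  integrator_lc : forall t, a < t -> t <= b ->
    integrator_fun x @[x --> t^'-] --> integrator_fun t }.

Definition right_lim (K : numFieldType) (f : R -> K) (t : R) : K :=
  lim (f x @[x --> t^'+]).

(* g extended to R by the constants g a (on the left) and g b (on the right) *)
Definition clamped a b (g : integrator a b) (t : R) : R :=
  g (Num.max a (Num.min t b)).

(* The library attaches Stieltjes measures to right-continuous functions f,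
   with ]s, t] |-> f t - f s. The right-continuous version of the clamped g
   yields the measure with [s, t[ |-> g t - g s (lemma mu_g_itv), which does
   not charge the complement of [a, b[. *)
Definition rc_version a b (g : integrator a b) (t : R) : R :=
  right_lim (clamped g) t.

Section cumulative.
Context (a b : R) (g : integrator a b).

Lemma clamped_nd : {homo clamped g : x y / x <= y}.
Proof.
move=> x y xy; rewrite /clamped; have [ab|ba] := leP a b.
  apply: integrator_nd.
  - by rewrite le_max lexx.
  - have m : Num.min x b <= Num.min y b by rewrite le_min !ge_min xy lexx orbT.
    by rewrite ge_max !le_max lexx m orbT.
  - by rewrite ge_max ab ge_min lexx orbT.
have E z : Num.max a (Num.min z b) = a.
  by apply/max_idPl; rewrite ge_min (ltW ba) orbT.
by rewrite !E.
Qed.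

Lemma clampedE t : a <= t -> t <= b -> clamped g t = g t.
Proof. by move=> at_ tb; rewrite /clamped (min_idPl tb) (max_idPr at_). Qed.

Lemma rc_version_cvg t : clamped g x @[x --> t^'+] --> rc_version g t.
Proof.
have /cvg_ex[l cl] : cvg (clamped g x @[x --> t^'+]).
  apply: nondecreasing_at_right_is_cvgr.
    by near=> x => y z _ _; exact: clamped_nd.
  near=> x; exists (clamped g t) => _ [y /= /[!in_itv]/= /andP[ty _] <-].
  exact/clamped_nd/ltW.
by rewrite /rc_version /right_lim (cvg_lim _ cl).
Unshelve. all: by end_near. Qed.

Lemma rc_version_ge t : clamped g t <= rc_version g t.
Proof.
apply: (cvgr_to_ge (@rc_version_cvg t)).
by near=> x; apply: clamped_nd; apply: ltW; near: x; exact: nbhs_right_gt.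
Unshelve. all: by end_near. Qed.

Lemma rc_version_le s t : s < t -> rc_version g s <= clamped g t.
Proof.
move=> st; apply: (cvgr_to_le (@rc_version_cvg s)).
by near=> x; apply: clamped_nd; apply: ltW; near: x; exact: nbhs_right_lt.
Unshelve. all: by end_near. Qed.

Lemma rc_version_nd : nondecreasing (rc_version g).
Proof.
move=> s t; rewrite le_eqVlt => /predU1P[->//|st].
exact: le_trans (rc_version_le st) (rc_version_ge t).
Qed.

Lemma rc_version_rc : right_continuous (rc_version g).
Proof.
move=> t; apply/cvgrPdist_le => e e0.
have /cvgrPdist_le/(_ e e0) := @rc_version_cvg t.
move=> [d /= d0 H]; near=> x.
have tx : t < x by near: x; exact: nbhs_right_gt.
have xd : x < t + d by near: x; apply: nbhs_right_lt; rewrite ltrDl.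
have ty : x < (x + (t + d)) / 2 < t + d by rewrite midf_lt//= midf_lt.
set y := _ / 2 in ty; case/andP: ty => xy yd.
have ty : t < y := lt_trans tx xy.
have Gy : rc_version g t <= clamped g y by exact: rc_version_le.
have := H y; rewrite /= => /(_ _ ty).
rewrite [`|t - y|]distrC gtr0_norm ?subr_gt0// ltrBlDl => /(_ yd).
rewrite distrC ger0_norm ?subr_ge0// => Gye.
rewrite distrC ger0_norm ?subr_ge0; last exact/rc_version_nd/ltW.
by apply: le_trans Gye; rewrite lerD2r; exact: rc_version_le.
Unshelve. all: by end_near. Qed.

HB.instance Definition _ :=
  isCumulative.Build R _ R (rc_version g) rc_version_nd rc_version_rc.

End cumulative.

(* R with the Caratheodory sigma-algebra of the outer measure, which is the
   completion of the Borel sigma-algebra since the measure is finite *)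
Definition mu_g_space a b (g : integrator a b) :=
  caratheodory_type (wlength (rc_version g))^*%mu.

Definition mu_g a b (g : integrator a b) : set (mu_g_space g) -> \bar R :=
  completed_lebesgue_stieltjes_measure (rc_version g).
Arguments mu_g {a b} g.

HB.instance Definition _ a b (g : integrator a b) := Measurable.on (mu_g_space g).
HB.instance Definition _ a b (g : integrator a b) := Measure.on (mu_g g).

Section mu_g_intervals.
Context (a b : R) (g : integrator a b).
Local Notation G := (rc_version g).

Lemma mu_g_measurable (A : set R) :
  measurable (A : set (measurableTypeR R)) -> measurable (A : set (mu_g_space g)).
Proof. exact: sub_caratheodory. Qed.

Lemma clamped_lc t : clamped g x @[x --> t^'-] --> clamped g t.
Proof.
have [ab|ba] := leP a b; last first.
  have E z : clamped g z = g a.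
    by congr (g _); apply/max_idPl; rewrite ge_min (ltW ba) orbT.
  by rewrite E; apply: cvg_near_cst; near=> x; exact: E.
have [ta|at_] := leP t a.
  have E z : z <= a -> clamped g z = g a.
    by move=> za; congr (g _); apply/max_idPl; rewrite ge_min za.
  rewrite E//; apply: cvg_near_cst; near=> x; apply: E.
  by apply: le_trans ta; apply: ltW; near: x; exact: nbhs_left_lt.
have [tb|bt] := leP t b.
  rewrite clampedE ?(ltW at_)//.
  apply: cvg_trans (integrator_lc at_ tb); apply: near_eq_cvg; near=> x.
  rewrite clampedE//; first by apply: ltW; near: x; exact: nbhs_left_gt.
  by apply: le_trans tb; apply: ltW; near: x; exact: nbhs_left_lt.
have E z : b <= z -> clamped g z = g b.
  by move=> bz; rewrite /clamped (min_idPr bz) (max_idPr ab).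
rewrite E ?(ltW bt)//; apply: cvg_near_cst; near=> x; apply: E.
by apply: ltW; near: x; exact: nbhs_left_gt.
Unshelve. all: by end_near. Qed.

Lemma mu_g_oo s t : s < t -> mu_g g `]s, t[ = (clamped g t - G s)%:E.
Proof.
move=> st; pose I n : set R := [set` `]s, t - n.+1%:R^-1]].
have mI n : measurable (I n : set (mu_g_space g)).
  by apply: mu_g_measurable; exact: measurable_itv.
have UI : `]s, t[%classic = \bigcup_n I n by exact: itv_bnd_open_bigcup.
have inv_cvg : t - n.+1%:R^-1 @[n --> \oo] --> t.
  rewrite -[X in _ --> X]subr0; apply: cvgB; first exact: cvg_cst.
  exact: cvg_harmonic.
have c1 : (mu_g g \o I) n @[n --> \oo] --> mu_g g `]s, t[.
  rewrite UI; apply: nondecreasing_cvg_mu => //.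
    by apply: bigcupT_measurable.
  move=> m n mn; apply/subsetPset; apply: subset_itvl.
  by rewrite bnd_simp lerB// lef_pV2 ?posrE// ler_nat.
have c2 : (mu_g g \o I) n @[n --> \oo] --> (clamped g t - G s)%:E.
  have c3 : (G (t - n.+1%:R^-1) - G s)%:E @[n --> \oo] --> (clamped g t - G s)%:E.
    apply: cvg_EFin; first by near=> n.
    apply: cvgB; last exact: cvg_cst.
    apply: (@squeeze_cvgr _ _ _ _ (fun n => clamped g (t - n.+1%:R^-1))
       (fun=> clamped g t)).
    - near=> n; rewrite rc_version_ge rc_version_le// ltrBlDr ltrDl.
      by rewrite invr_gt0.
    - have /cvg_at_leftP := @clamped_lc t; apply; split => // n.
      by rewrite ltrBlDr ltrDl invr_gt0.
    - exact: cvg_cst.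
  apply: cvg_trans c3; apply: near_eq_cvg; near=> n => /=.
  have sn : s <= t - n.+1%:R^-1.
    by near: n; apply: (cvgr_ge t inv_cvg).
  rewrite /mu_g /completed_lebesgue_stieltjes_measure.
  rewrite /completed_measure_extension /I measurable_mu_extE/=; last first.
    exact: is_ocitv.
  by rewrite wlength_itv_bnd.
exact: (cvg_unique _ c1 c2).
Unshelve. all: by end_near. Qed.

Lemma mu_g_co s t : s <= t -> mu_g g `[s, t[ = (clamped g t - clamped g s)%:E.
Proof.
rewrite le_eqVlt => /predU1P[->|st]; first by rewrite set_itvxx measure0 subrr.
have s1 : s - 1 < s by rewrite ltrBlDr ltrDl.
have s1t := lt_trans s1 st.
have := mu_g_oo s1t.
rewrite (@itv_bndbnd_setU _ R (BRight (s - 1)) (BLeft s)); last 2 first.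
- by rewrite bnd_simp.
- by rewrite bnd_simp ltW.
set A := `]s - 1, s[%classic; set B := `[s, t[%classic.
have -> : mu_g g (A `|` B) = (mu_g g A + mu_g g B)%E.
  apply: measureU; try by apply: mu_g_measurable; exact: measurable_itv.
  rewrite /A /B -subset0 => x [] /=; rewrite !in_itv/= => /andP[_ xs] /andP[sx _].
  by have := le_lt_trans sx xs; rewrite ltxx.
rewrite (mu_g_oo s1); case: (mu_g g B) => //= r [] E.
by congr EFin; lra.
Qed.

Lemma mu_g_itv s t : a <= s -> s <= t -> t <= b ->
  mu_g g `[s, t[ = (g t - g s)%:E.
Proof.
move=> as_ st tb; rewrite mu_g_co// !clampedE//.
- exact: le_trans st tb.
- exact: le_trans as_ st.
Qed.

Lemma mu_g_setC : a <= b -> mu_g g (~` `[a, b[) = 0%E.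
Proof.
move=> ab; apply: measure_negligible.
  by apply: mu_g_measurable; apply: measurableC; exact: measurable_itv.
rewrite setCitv; apply: negligibleU.
- rewrite [X in _.-negligible X]itvNy_bnd_bigcup_BLeft.
  apply: negligible_bigcup => n; apply/negligibleP.
    by apply: mu_g_measurable; exact: measurable_itv.
  have an : a - n%:R <= a by rewrite gerBl ler0n.
  apply: etrans (mu_g_co an) _; rewrite /clamped !(max_idPl _) ?subrr//.
  + by rewrite ge_min an.
  + by rewrite ge_min lexx.
- rewrite [X in _.-negligible X](itv_bndy_bigcup_BLeft_shift true b 0).
  apply: negligible_bigcup => n; apply/negligibleP.
    by apply: mu_g_measurable; exact: measurable_itv.
  have bn : b <= b + n%:R by rewrite lerDl ler0n.
  rewrite addn0.
  by apply: etrans (mu_g_co bn) _; rewrite /clamped minxx (min_idPr bn) subrr.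
Qed.

Lemma mu_g_complete : measure_is_complete (mu_g g).
Proof. exact: measure_is_complete_caratheodory. Qed.

End mu_g_intervals.

End integrator.
Arguments mu_g {R a b} g.

Variant scalar_field := RealField | ComplexField.

Section scalars.
Variable R : realType.

Definition scalar (k : scalar_field) : numFieldType :=
  match k with RealField => R | ComplexField => R[i] end.

Definition scalar_Re k : scalar k -> R :=
  match k with RealField => id | ComplexField => @complex.Re R end.

Definition scalar_Im k : scalar k -> R :=
  match k with RealField => fun=> 0 | ComplexField => @complex.Im R end.

(* x + i y; y is dropped over the reals *)
Definition to_scalar k : R -> R -> scalar k :=
  match k with RealField => fun x _ => x | ComplexField => @Complex R end.

Definition of_real k (x : R) : scalar k := to_scalar k x 0.

End scalars.
Arguments scalar_Re {R k}.
Arguments scalar_Im {R k}.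
Arguments to_scalar {R} k.
Arguments of_real {R} k.

Section stieltjes.
Context {R : realType} {a b : R} (g : integrator a b).

Section scalar_functions.
Context {k : scalar_field}.
Local Notation K := (scalar R k).

Definition measurable_g (f : R -> K) : Prop :=
  measurable_fun (`[a, b[ : set (mu_g_space g)) (scalar_Re \o f) /\
  measurable_fun (`[a, b[ : set (mu_g_space g)) (scalar_Im \o f).

Definition L1_g (f : R -> K) : Prop :=
  (mu_g g).-integrable `[a, b[ (EFin \o (scalar_Re \o f)) /\
  (mu_g g).-integrable `[a, b[ (EFin \o (scalar_Im \o f)).

Definition Loo_g (f : R -> K) : Prop :=
  measurable_g f /\
  exists M : R, {ae mu_g g, forall t, t \in `[a, b[ -> `|f t| <= of_real k M}.

Definition int_g (D : set R) (f : R -> K) : K :=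
  to_scalar k (\int[mu_g g]_(t in D) scalar_Re (f t))
              (\int[mu_g g]_(t in D) scalar_Im (f t)).

Definition AC_g (u : R -> K) : Prop :=
  forall e : R, 0 < e -> exists2 delta : R, 0 < delta &
    forall (n : nat) (l r : 'I_n -> R),
      (forall j, [/\ a <= l j, l j < r j & r j <= b]) ->
      trivIset setT (fun j => `[l j, r j[%classic) ->
      \sum_(j < n) (g (r j) - g (l j)) < delta ->
      \sum_(j < n) `|u (r j) - u (l j)| < of_real k e.

Definition jump (t : R) : Prop := (t \in `[a, b[) /\ 0 < right_lim g t - g t.

Definition posterior_trace (phi : R -> K) (t : R) : K :=
  if `[< jump t >] then right_lim phi t else phi t.

(* phi is in the test space and psi is its Stieltjes derivative *)
Definition test_function (phi psi : R -> K) : Prop :=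
  Loo_g psi /\
  exists c : K, forall t, t \in `[a, b] -> phi t = c + int_g `[a, t[ psi.

End scalar_functions.

Section vector_functions.
Context {d : nat}.
Implicit Types (u : R -> 'rV[R]_d) (F : R -> 'rV[R]_d -> 'rV[R]_d).

(* the Euclidean norm; the library norm on 'rV[R]_d is the max norm *)
Definition enorm (x : 'rV[R]_d) : R := Num.sqrt (\sum_i x ord0 i ^+ 2).

(* R^d-valued notions are componentwise, with real components whatever the
   scalar field of the test functions *)
Definition vL1_g u : Prop :=
  forall i, L1_g (k := RealField) (fun t => u t ord0 i).

Definition vint_g (D : set R) u : 'rV[R]_d :=
  \row_i int_g (k := RealField) D (fun t => u t ord0 i).

Definition vAC_g u : Prop :=
  forall i, AC_g (k := RealField) (fun t => u t ord0 i).

Definition caratheodory_lipschitz F : Prop :=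
  [/\ forall x i, measurable_g (k := RealField) (fun t => F t x ord0 i),
      {ae mu_g g, forall t, t \in `[a, b[ -> continuous (F t)} &
      exists m L : R -> R,
        [/\ L1_g (k := RealField) m, L1_g (k := RealField) L,
            forall t, t \in `[a, b[ -> 0 <= m t /\ 0 <= L t,
            {ae mu_g g, forall t, t \in `[a, b[ -> enorm (F t 0) <= m t} &
            {ae mu_g g, forall t, t \in `[a, b[ ->
              forall x y, enorm (F t x - F t y) <= L t * enorm (x - y)}]].

Definition global_weak_solution (k : scalar_field) F u (u0 ub : 'rV[R]_d)
    : Prop :=
  [/\ vL1_g u, vL1_g (fun t => F t (u t)) &
      forall phi psi : R -> scalar R k, test_function phi psi -> forall i,
        int_g `[a, b[ (fun t => of_real k (u t ord0 i) * psi t) +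
        int_g `[a, b[
          (fun t => of_real k (F t (u t) ord0 i) * posterior_trace phi t) =
        of_real k (ub ord0 i) * phi b - of_real k (u0 ord0 i) * phi a].

End vector_functions.
End stieltjes.

(* Main.v *)
(** Write f(t) = F(t, u(t)) and V(t) = \int_[a,t) f. At every t in [a, b) the
    posterior trace of phi = c + \int_[a,.) psi is c + \int_[a,t] psi: at a jump
    this is the limit from the right, elsewhere {t} is null. Exchanging the
    integrals over s <= t therefore turns the left-hand side of the weak
    identity into \int (u - V) psi + V(b) phi(b). Taking psi = 0 gives
    V(b) = u_b - u_0, and taking c = 0 and psi the sign of u - V - u_0 gives
    u = u_0 + V almost everywhere. Conversely an AC_g representative is bounded,
    which makes F(., u(.)) integrable, and the identity is read backwards.
    Complex test functions are treated through their real and imaginary parts. *)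

Require Import Defs.
From HB Require Import structures.
From mathcomp Require Import all_boot all_order all_algebra.
From mathcomp Require Import complex ring lra.
From mathcomp Require Import all_classical all_reals all_analysis.
From mathcomp Require Import measurable_realfun.

Set Implicit Arguments.
Unset Strict Implicit.
Unset Printing Implicit Defensive.
Import Order.TTheory GRing.Theory Num.Theory.
Import numFieldNormedType.Exports.
Local Open Scope classical_set_scope.
Local Open Scope ring_scope.

(** * Fubini's theorem for products of integrable functions over a measurable set of pairs *)

Section fubini_indicator.
Context d (T : measurableType d) (R : realType).
Implicit Types (f r : T -> R) (A : set (T * T)).

Lemma integrableM_indic (mu : {measure set T -> \bar R}) f (B : set T) :
  mu.-integrable setT (EFin \o f) -> measurable B ->
  mu.-integrable setT (EFin \o (fun t => f t * \1_B t)).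
Proof.
move=> intf mB.
have -> : EFin \o (fun t => f t * \1_B t) = ((EFin \o f) \* (EFin \o \1_B))%E.
  exact/funext.
apply: integrableMl => //; exists 1; split=> // M M1 t _ /=.
apply: le_trans (ltW M1); rewrite indicE.
by case: (_ \in _); rewrite ?normr1 ?normr0.
Qed.

Variable mu : {sigma_finite_measure set T -> \bar R}.

(** By Tonelli: the indicator is at most 1, so for fixed t the inner integral of the absolute value
    is at most |f t| times the L1 norm of r, which is integrable in t. *)
Lemma integrable_prod_indic f r A :
  mu.-integrable setT (EFin \o f) -> mu.-integrable setT (EFin \o r) ->
  measurable A ->
  (mu \x mu)%E.-integrable setT (EFin \o (fun z => f z.1 * r z.2 * \1_A z)).
Proof.
move=> intf intr mA; pose h z : R := f z.1 * r z.2 * \1_A z.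
have mf : measurable_fun setT f.
  by apply/measurable_EFinP; exact: measurable_int intf.
have mr : measurable_fun setT r.
  by apply/measurable_EFinP; exact: measurable_int intr.
have mh : measurable_fun setT (EFin \o h).
  apply/measurable_EFinP; apply: measurable_funM; last exact: measurable_indic.
  apply: measurable_funM; first exact: measurableT_comp mf measurable_fst.
  exact: measurableT_comp mr measurable_snd.
apply/integrable12ltyP => //.
set Ir := (\int[mu]_s `|(r s)%:E|)%E.
have Irfin : Ir \is a fin_num.
  rewrite ge0_fin_numE; last exact: integral_ge0.
  by case/integrableP: intr.
have mabsf : measurable_fun setT (fun t => `|(f t)%:E|)%E.
  by apply: measurableT_comp => //; exact/measurable_EFinP.
have mabsr : measurable_fun setT (fun t => `|(r t)%:E|)%E.
  by apply: measurableT_comp => //; exact/measurable_EFinP.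
apply: (@le_lt_trans _ _ (\int[mu]_t (`|(f t)%:E| * Ir))%E).
  apply: ge0_le_integral => //.
  - by move=> t _; exact: integral_ge0.
  - apply: (measurable_fun_fubini_tonelli_F (abse \o (EFin \o h))) => //=.
    exact: measurableT_comp.
  - by apply: emeasurable_funM.
  move=> t _; rewrite -ge0_integralZl//; apply: ge0_le_integral => //.
  - apply: (measurableT_comp (f := abse)) => //.
    exact: (measurableT_comp mh (measurable_pair1 t)).
  - by apply: emeasurable_funM.
  move=> s _ /=; rewrite -EFinM lee_fin /= !normrM ler_piMr ?mulr_ge0//.
  by rewrite indicE; case: (_ \in _); rewrite ?normr1 ?normr0.
rewrite -(fineK Irfin) ge0_integralZr//; last exact/fine_ge0/integral_ge0.
rewrite muleC lte_mul_pinfty ?lee_fin ?fine_ge0 ?integral_ge0//.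
by case/integrableP: intf.
Qed.

(** Links the extended-real inner integrals produced by Fubini to real-valued ones: the section of
    [A] at t is measurable, so the integral is finite and the constant f t comes out. *)
Lemma integral_xsectionM f r A t :
  mu.-integrable setT (EFin \o r) -> measurable A ->
  (\int[mu]_s (f t * r s * \1_A (t, s))%:E)%E =
  (f t * \int[mu]_s (r s * \1_A (t, s)))%:E.
Proof.
move=> intr mA.
have it : mu.-integrable setT (EFin \o (fun s => r s * \1_A (t, s))).
  have -> : (fun s => r s * \1_A (t, s)) = (fun s => r s * \1_(xsection A t) s).
    by apply/funext => s; rewrite !indicE mem_xsection.
  by apply: integrableM_indic => //; exact: measurable_xsection.
rewrite EFinM fineK; last exact: integrable_fin_num.
rewrite -integralZl//.
by apply: eq_integral => s _; rewrite -mulrA.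
Qed.

Lemma integrable_fubini_indic f r A :
  mu.-integrable setT (EFin \o f) -> mu.-integrable setT (EFin \o r) ->
  measurable A ->
  mu.-integrable setT
    (EFin \o (fun t => f t * \int[mu]_s (r s * \1_A (t, s)))).
Proof.
move=> intf intr mA.
have := integrable_fubini_F (integrable_prod_indic intf intr mA).
apply: eq_integrable => //.
by move=> t _; rewrite /fubini_F /= integral_xsectionM.
Qed.

Lemma Rintegral_fubini_indic f r A :
  mu.-integrable setT (EFin \o f) -> mu.-integrable setT (EFin \o r) ->
  measurable A ->
  \int[mu]_t (f t * \int[mu]_s (r s * \1_A (t, s))) =
  \int[mu]_s (r s * \int[mu]_t (f t * \1_A (t, s))).
Proof.
move=> intf intr mA.
(* Exchanging the coordinates turns integration over the first variable into integration over the
   second, so that [integral_xsectionM] serves for both orders. *)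
have mA' : measurable [set z | A (z.2, z.1)].
  have := @measurable_swap _ _ T T measurableT A mA.
  by rewrite setTI.
have := Fubini (integrable_prod_indic intf intr mA) => /(congr1 fine) /=.
under eq_integral do rewrite integral_xsectionM//.
move=> E; rewrite {1}/Rintegral E; congr fine; apply: eq_integral => s _.
have ind t : \1_A (t, s) = \1_[set z | A (z.2, z.1)] (s, t) :> R.
  by rewrite !indicE /in_mem /=; congr (nat_of_bool _)%:R; apply: asbool_equiv_eq.
rewrite /Rintegral; under [in RHS]eq_integral do rewrite ind.
rewrite -(integral_xsectionM r s intf mA').
by apply: eq_integral => t _; rewrite ind (mulrC (r s)).
Qed.

End fubini_indicator.

(** * Measurability for complete measures, domination, absolute continuity of the integral *)

Section measurability.
Context d (T : measurableType d) (R : realType).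
Variable mu : {measure set T -> \bar R}.

(** Cut off on a null set, the sequence converges everywhere, so the cut-off limit is measurable;
    completeness transfers this to f. *)
Lemma ae_cvg_measurable_fun (D : set T) (f_ : nat -> T -> R) (f : T -> R) :
  measure_is_complete mu -> measurable D ->
  (forall n, measurable_fun D (f_ n)) ->
  {ae mu, forall x, D x -> f_ n x @[n --> \oo] --> f x} ->
  measurable_fun D f.
Proof.
move=> cmu mD mf_ [N [mN N0 subN]].
have mCN : measurable (~` N) by exact: measurableC.
apply/measurable_EFinP.
apply: (@ae_measurable_fun _ _ _ _ cmu _ (EFin \o (f \_ (~` N)))).
  exists N; split=> // x /= bad; apply: contrapT => Nx; apply: bad => Dx.
  by rewrite patchE mem_set.
apply/measurable_EFinP.
apply: (@measurable_fun_cvg _ _ _ _ (fun n => f_ n \_ (~` N))).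
  move=> n; apply: (proj1 (measurable_restrict _ mCN mD)).
  exact: measurable_funS (mf_ n).
move=> x Dx; rewrite patchE; have [xN|xN] := boolP (x \in ~` N).
  under eq_fun do rewrite patchE xN.
  apply: contrapT => nc; move: xN; rewrite inE; apply; apply: subN => /=.
  by move=> /(_ Dx).
by under eq_fun do rewrite patchE (negbTE xN); exact: cvg_cst.
Qed.

(** Completeness makes h measurable along with f. This allows the replacement of u by another
    representative inside F. *)
Lemma ae_eq_Rintegral (D : set T) (f h : T -> R) :
  measure_is_complete mu -> measurable D -> measurable_fun D f ->
  {ae mu, forall x, D x -> f x = h x} ->
  \int[mu]_(x in D) f x = \int[mu]_(x in D) h x.
Proof.
move=> cmu mD /measurable_EFinP mf fh.
have fhE : ae_eq mu D (EFin \o f) (EFin \o h).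
  by apply: filterS fh => x fx /fx /= ->.
by congr fine; apply: ae_eq_integral => //; exact: ae_measurable_fun fhE mf.
Qed.

(** Each coordinate moves by at most 1 / (k + 1), uniformly over the coordinates, which is what
    convergence in the max norm requires. *)
Lemma cvg_floor_row n (v : 'rV[R]_n) :
  (\row_i ((Num.floor (k.+1%:R * v ord0 i))%:~R / k.+1%:R) : 'rV[R]_n)
    @[k --> \oo] --> v.
Proof.
apply/cvg_ballP => e e0.
have : harmonic k @[k --> \oo] --> (0 : R) by exact: cvg_harmonic.
move=> /cvgrPdist_lt/(_ _ e0); apply: filterS => k; rewrite sub0r normrN /= => hk.
split=> // i j; rewrite mxE /ball /= ord1; set x := v ord0 j.
move: hk; rewrite ger0_norm ?invr_ge0 ?ler0n//; apply: le_lt_trans.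
have : 0 < k.+1%:R :> R by rewrite ltr0n.
set c : R := k.+1%:R => c0.
have /andP[fl] := floor_itv (c * x); rewrite intrD.
set z := (Num.floor (c * x))%:~R in fl * => fu.
have -> : x - z / c = (c * x - z) / c by field; rewrite gt_eqF.
rewrite ger0_norm ?divr_ge0 ?subr_ge0 ?(ltW c0)// -[leRHS]mul1r.
by rewrite ler_wpM2r ?invr_ge0 ?(ltW c0)// lerBlDl (ltW fu).
Qed.

(* F (t, v t) is measurable when v takes countably many values, and rounding u
   to a grid of mesh 1 / (k + 1) gives such v converging to u. *)
Lemma measurable_fun_caratheodory (D : set T) n (F : T -> 'rV[R]_n -> R)
    (u : T -> 'rV[R]_n) : measure_is_complete mu -> measurable D ->
  (forall x, measurable_fun D (F ^~ x)) ->
  {ae mu, forall t, D t -> continuous (F t)} ->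
  (forall i, measurable_fun D (fun t => u t ord0 i)) ->
  measurable_fun D (fun t => F t (u t)).
Proof.
move=> cmu mD mF cF mu_.
pose q k t : 'rV[int]_n := \row_i Num.floor (k.+1%:R * u t ord0 i).
pose s k (z : 'rV[int]_n) : 'rV[R]_n := \row_i ((z ord0 i)%:~R / k.+1%:R).
apply: (@ae_cvg_measurable_fun _ (fun k t => F t (s k (q k t)))) => //; last first.
  apply: filterS cF => t ct Dt; apply: continuous_cvg; first exact: ct.
  rewrite (_ : (fun k => s k (q k t)) = fun k =>
    \row_i ((Num.floor (k.+1%:R * u t ord0 i))%:~R / k.+1%:R)).
    exact: cvg_floor_row.
  by apply/funext => k; apply/rowP => i; rewrite !mxE.
move=> k _ B mB.
(* The fibre over z is given by finitely many conditions z_i <= (k + 1) u_i < z_i + 1. *)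
have mq z : measurable (D `&` [set t | q k t = z]).
  rewrite [X in measurable X](_ : _ = D `&` \bigcap_(i in [set: 'I_n])
      (D `&` (fun t => k.+1%:R * u t ord0 i) @^-1`
        `[(z ord0 i)%:~R, (z ord0 i + 1)%:~R[)).
    apply: measurableI => //; apply: fin_bigcap_measurable => // i _.
    have mk : measurable_fun D (fun t => k.+1%:R * u t ord0 i).
      by apply: measurable_funM.
    by apply: mk.
  apply/seteqP; split=> t /= [Dt].
    move=> <-; split=> // i _; split=> //=.
    by rewrite in_itv /= !mxE floor_itv.
  move=> H; split=> //; apply/rowP => i; rewrite mxE.
  by have [_ /=] := H i I; rewrite in_itv /= => /floor_def.
(* The preimage of B is a countable union over z; on each piece the second argument of F is
   constant. *)
rewrite [X in measurable X](_ : _ = \bigcup_(z : 'rV[int]_n)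
   ((D `&` [set t | q k t = z]) `&` (D `&` (F ^~ (s k z)) @^-1` B))).
  apply: countable_bigcupT_measurable => [|z]; first exact: countableP.
  by apply: measurableI => //; exact: mF.
apply/seteqP; split=> t /=.
  by move=> [Dt BF]; exists (q k t).
by move=> [z _ [[Dt <-] [_ BF]]].
Qed.

Lemma measurable_fun_sgn (D : set T) (w : T -> R) :
  measurable D -> measurable_fun D w ->
  measurable_fun D (fun t => if 0 <= w t then 1 else -1 : R).
Proof.
move=> mD mw; apply: measurable_fun_if => //.
by apply: measurable_fun_ler.
Qed.

Lemma ae_le_integrable (D : set T) (f h : T -> R) : measurable D ->
  measurable_fun D f -> mu.-integrable D (EFin \o h) ->
  {ae mu, forall x, D x -> `|f x| <= `|h x|} ->
  mu.-integrable D (EFin \o f).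
Proof.
move=> mD mf ih fh; apply/integrableP; split; first exact/measurable_EFinP.
apply: le_lt_trans (proj2 (integrableP _ _ _ ih)).
apply: ae_ge0_le_integral => //.
- by apply: measurableT_comp => //; exact/measurable_EFinP.
- by apply: measurableT_comp => //; exact: measurable_int ih.
Qed.

Lemma integrableM_ae_bounded (D : set T) (M : R) (u r : T -> R) :
  measurable D -> mu.-integrable D (EFin \o u) -> measurable_fun D r ->
  {ae mu, forall x, D x -> `|r x| <= M} ->
  mu.-integrable D (EFin \o (fun x => u x * r x)).
Proof.
move=> mD iu mr bM.
have i2 : mu.-integrable D (EFin \o (fun x => M * u x)).
  by have := @integrableZl _ _ _ mu _ mD M _ iu.
apply: ae_le_integrable i2 _ => //.
  by apply: measurable_funM => //; apply/measurable_EFinP; exact: measurable_int iu.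
apply: filterS bM => x bx /bx {}bx; rewrite normrM mulrC normrM.
by rewrite ler_wpM2r// (le_trans bx)// ler_norm.
Qed.

(** Absolute continuity of the integral on the union of the family: measure and integral are both
    additive there. The finite-family form matches the definition of [AC_g]. *)
Lemma sum_Rintegral_norm_lt (f : T -> R) (e : R) :
  mu.-integrable setT (EFin \o f) -> 0 < e ->
  exists2 delta : R, 0 < delta & forall n (A : 'I_n -> set T),
    (forall j, measurable (A j)) -> trivIset setT A ->
    (\sum_(j < n) mu (A j) < delta%:E)%E ->
    \sum_(j < n) \int[mu]_(x in A j) `|f x| < e.
Proof.
move=> intf e0; have [delta [d0 H]] := integral_normr_continuous intf e0.
exists delta => // n A mA tA.
rewrite -measure_bigsetU_ord// => /H H'.
have mf : measurable_fun setT (fun x => `|f x|%:E).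
  apply/measurable_EFinP/measurableT_comp => //.
  by apply/measurable_EFinP; exact: measurable_int intf.
apply: le_lt_trans (H' _); last exact: bigsetU_measurable.
rewrite {2}/Rintegral ge0_integral_bigsetU ?index_enum_uniq//=; first last.
- exact: measurable_funS mf.
- exact: sub_trivIset tA.
rewrite -sum_fine// => j _; apply: integrable_fin_num => //.
by apply: integrableS (integrable_norm intf).
Qed.

End measurability.

(** Sigma-finiteness is what Fubini's theorem asks of [mu_g]. *)
HB.instance Definition _ (R : realType) (a b : R) (g : integrator a b) :=
  SigmaFiniteMeasure.copy (mu_g g)
    (completed_lebesgue_stieltjes_measure (rc_version g)).

(* The library's hints do not find this filter through [mu_g]. *)
#[local] Instance ae_mu_g_filter (R : realType) (a b : R) (g : integrator a b) :
  Filter (almost_everywhere (mu_g g)) := ae_filter_ringOfSetsType (mu_g g).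

(** * Exchange of the integrals over s <= t *)

Section real_functions.
Context {R : realType} {a b : R} (g : integrator a b).
Local Notation mu := (mu_g g).
Local Notation T := (mu_g_space g).
Implicit Types f r : T -> R.

Lemma measurable_itv_g (i : interval R) : measurable ([set` i] : set T).
Proof. by apply: mu_g_measurable; exact: measurable_itv. Qed.
Hint Extern 0 (measurable [set` _]) => exact: measurable_itv_g : core.

Lemma measurable_fun_id_g (D : set T) : measurable_fun D (id : T -> R).
Proof. by move=> mD B mB; apply: measurableI => //; exact: mu_g_measurable. Qed.

Let measurable_le_g :
  measurable [set z : T * T | (z.2 : R) <= (z.1 : R)].
Proof.
rewrite (_ : [set _ | _] = setT `&` [set z | (EFin z.2 <= EFin z.1)%E]).
  apply: measurable_lee => //; apply/measurable_EFinP.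
  - exact: (measurableT_comp (@measurable_fun_id_g setT) measurable_snd).
  - exact: (measurableT_comp (@measurable_fun_id_g setT) measurable_fst).
by rewrite setTI; apply/seteqP; split=> z; rewrite /= lee_fin.
Qed.

Let measurable_ge_g :
  measurable [set z : T * T | (z.1 : R) <= (z.2 : R)].
Proof.
by have := @measurable_swap _ _ T T measurableT _ measurable_le_g; rewrite setTI.
Qed.

Section exchange.
Variables f r : T -> R.
Hypothesis intf : mu.-integrable `[a, b[ (EFin \o f).
Hypothesis intr : mu.-integrable `[a, b[ (EFin \o r).

(** Extension by zero, since the Fubini lemmas above integrate over the whole space. *)
Let ext (h : T -> R) : T -> R := h \_ (`[a, b[ : set T).

Let int_ext h : mu.-integrable `[a, b[ (EFin \o h) ->
  mu.-integrable setT (EFin \o ext h).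
Proof.
move=> inth; rewrite /ext -restrict_EFin.
exact: (proj1 (integrable_mkcond _ (measurable_itv_g _))).
Qed.

(** Pairs (t, s) with s <= t. The diagonal is included, so the inner domains are the closed [[a, t]]
    and the half-open [[s, b[]; atoms of the measure make this choice matter. *)
Let A : set (T * T) := [set z | (z.2 : R) <= (z.1 : R)].

Let extr_le t : t \in `[a, b[ ->
  \int[mu]_s (ext r s * \1_A (t, s)) = \int[mu]_(s in `[a, t]) r s.
Proof.
move=> /[1!in_itv] /= /andP[_ tb]; rewrite [RHS]Rintegral_mkcond.
apply: eq_Rintegral => s _; rewrite /ext !patchE indicE.
have -> : ((t, s) \in A) = (s <= t).
  by apply/idP/idP => [/set_mem//|st]; exact: mem_set.
rewrite !mem_setE !in_itv /=; have [st|ts] := leP s t.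
  by rewrite (le_lt_trans st tb) !andbT mulr1.
by rewrite andbF mulr0.
Qed.

Let extf_ge s : s \in `[a, b[ ->
  \int[mu]_t (ext f t * \1_A (t, s)) = \int[mu]_(t in `[s, b[) f t.
Proof.
move=> /[1!in_itv] /= /andP[as_ _]; rewrite [RHS]Rintegral_mkcond.
apply: eq_Rintegral => t _; rewrite /ext !patchE indicE.
have -> : ((t, s) \in A) = (s <= t).
  by apply/idP/idP => [/set_mem//|st]; exact: mem_set.
rewrite !mem_setE !in_itv /=; have [st|ts] := leP s t.
  by rewrite (le_trans as_ st) mulr1.
by rewrite /= mulr0.
Qed.

Let extM (h k k' : T -> R) : (forall t, t \in `[a, b[ -> k t = k' t) ->
  (fun t => ext h t * k t) = (fun t => h t * k' t) \_ (`[a, b[ : set T).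
Proof.
move=> kk'; apply/funext => t; rewrite /ext !patchE mem_setE.
by case: ifPn => [/kk' ->//|_]; rewrite mul0r.
Qed.

Lemma integrable_primitiveM :
  mu.-integrable `[a, b[ (EFin \o (fun t => f t * \int[mu]_(s in `[a, t]) r s)).
Proof.
apply: (proj2 (integrable_mkcond _ (measurable_itv_g _))).
rewrite restrict_EFin -(extM _ extr_le).
by apply: integrable_fubini_indic; [exact: int_ext..|exact: measurable_le_g].
Qed.

Lemma integrable_primitive_geM :
  mu.-integrable `[a, b[ (EFin \o (fun s => r s * \int[mu]_(t in `[s, b[) f t)).
Proof.
apply: (proj2 (integrable_mkcond _ (measurable_itv_g _))).
(* Here the outer variable is s, so the triangle has to be transposed. *)
have indE (s t : T) :
    \1_A (t, s) = \1_[set z : T * T | (z.1 : R) <= z.2] (s, t) :> R.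
  by rewrite !indicE; congr (nat_of_bool _)%:R; apply/idP/idP => /set_mem/mem_set.
rewrite restrict_EFin -(extM _ extf_ge).
under eq_fun do under eq_Rintegral do rewrite indE.
by apply: integrable_fubini_indic; [exact: int_ext..|exact: measurable_ge_g].
Qed.

(** Fubini on the triangle [A]. It plays the part of integration by parts, the jump contributions
    being carried by the diagonal. *)
Lemma Rintegral_exchange :
  \int[mu]_(t in `[a, b[) (f t * \int[mu]_(s in `[a, t]) r s) =
  \int[mu]_(s in `[a, b[) (r s * \int[mu]_(t in `[s, b[) f t).
Proof.
rewrite [LHS]Rintegral_mkcond [RHS]Rintegral_mkcond.
rewrite -(extM _ extr_le) -(extM _ extf_ge).
by apply: Rintegral_fubini_indic; [exact: int_ext..|exact: measurable_le_g].
Qed.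

End exchange.
End real_functions.

(** * Primitives with respect to [mu_g] and the weak identity for real functions *)

Section primitives.
Context {R : realType} {a b : R} (g : integrator a b).
Local Notation mu := (mu_g g).
Local Notation T := (mu_g_space g).
Implicit Types f r u : T -> R.
Hypothesis ab : a < b.

Let mI (i : interval R) : measurable ([set` i] : set T).
Proof. exact: measurable_itv_g. Qed.
Hint Extern 0 (measurable [set` _]) => exact: mI : core.

Lemma mu_g_lty : (mu `[a, b[ < +oo)%E.
Proof. by rewrite mu_g_itv ?lexx ?(ltW ab)// ltry. Qed.

Lemma integrable_cst_g c : mu.-integrable `[a, b[ (EFin \o (fun=> c : R)).
Proof.
apply: measurable_bounded_integrable => //; first exact: mu_g_lty.
exact: bounded_cst.
Qed.

Lemma integrable_ae_bounded_g (M : R) r : measurable_fun (`[a, b[ : set T) r ->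
  {ae mu, forall x, x \in `[a, b[ -> `|r x| <= M} ->
  mu.-integrable `[a, b[ (EFin \o r).
Proof.
move=> mr bM; have := integrableM_ae_bounded (mI _) (integrable_cst_g 1) mr bM.
by apply: eq_integrable => // x _; rewrite /= mul1r.
Qed.

Lemma integrable_sub_itv_g f (i : interval R) : [set` i] `<=` `[a, b[%classic ->
  mu.-integrable `[a, b[ (EFin \o f) -> mu.-integrable [set` i] (EFin \o f).
Proof. by move=> ib; exact: integrableS (mI _) (mI _) ib. Qed.

(** Cutting at an interval bound rather than at a point treats open and closed ends at once. *)
Lemma Rintegral_split_g f (i : itv_bound R) (x y : itv_bound R) :
  (i <= x)%O -> (x <= y)%O ->
  mu.-integrable [set` Interval i y] (EFin \o f) ->
  \int[mu]_(t in [set` Interval i y]) f t =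
  \int[mu]_(t in [set` Interval i x]) f t + \int[mu]_(t in [set` Interval x y]) f t.
Proof.
move=> ix xy intf.
have E := itv_bndbnd_setU ix xy.
rewrite E Rintegral_setU //; first by rewrite -E.
apply/disj_setPS => t [] /=; rewrite !itv_boundlr => /andP[_ tx] /andP[xt _].
by have := le_trans tx xt; rewrite bnd_simp ltxx.
Qed.

(** The primitive is the total integral minus the tail over [[t, b[], and the tail is integrable by
    the exchange lemma with the constant 1. *)
Lemma integrable_primitive f : mu.-integrable `[a, b[ (EFin \o f) ->
  mu.-integrable `[a, b[ (EFin \o (fun t => \int[mu]_(s in `[a, t[) f s)).
Proof.
move=> intf.
have := integrableB (mI _) (integrable_cst_g (\int[mu]_(s in `[a, b[) f s))
  (integrable_primitive_geM intf (integrable_cst_g 1)).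
apply: eq_integrable => // t; rewrite mem_setE in_itv /= => /andP[at_ tb].
rewrite mul1r (@Rintegral_split_g f (BLeft a) (BLeft t) (BLeft b)) ?bnd_simp//.
- by rewrite -EFinB addrK.
- exact: ltW.
Qed.

(** Write V for the primitive of f. The exchange produces the tail of f over [[t, b[], equal to V(b)
    - V(t): the term -V(t) joins u, and V(b) collects the factor c plus the integral of r. *)
Lemma weak_form_identity (M c : R) u f r :
  mu.-integrable `[a, b[ (EFin \o u) -> mu.-integrable `[a, b[ (EFin \o f) ->
  measurable_fun (`[a, b[ : set T) r ->
  {ae mu, forall x, x \in `[a, b[ -> `|r x| <= M} ->
  \int[mu]_(t in `[a, b[) (u t * r t) +
  \int[mu]_(t in `[a, b[) (f t * (c + \int[mu]_(s in `[a, t]) r s)) =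
  \int[mu]_(t in `[a, b[) ((u t - \int[mu]_(s in `[a, t[) f s) * r t) +
  (\int[mu]_(t in `[a, b[) f t) * (c + \int[mu]_(t in `[a, b[) r t).
Proof.
move=> intu intf mr bM.
have intr := integrable_ae_bounded_g mr bM.
have intur := integrableM_ae_bounded (mI _) intu mr bM.
have intfr := integrable_primitiveM intf intr.
have intrf := integrable_primitive_geM intf intr.
set If := \int[mu]_(t in `[a, b[) f t.
have -> : \int[mu]_(t in `[a, b[) (f t * (c + \int[mu]_(s in `[a, t]) r s)) =
    \int[mu]_(t in `[a, b[) (c * f t + f t * \int[mu]_(s in `[a, t]) r s).
  by apply: eq_Rintegral => t _; rewrite mulrDr (mulrC _ c).
have intZ (k : R) (h : T -> R) : mu.-integrable `[a, b[ (EFin \o h) ->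
  mu.-integrable `[a, b[ (EFin \o (fun x => k * h x)).
  by move=> ih; have := @integrableZl _ _ _ mu _ (mI _) k _ ih.
rewrite RintegralD//; last exact: intZ.
rewrite RintegralZl// -/If Rintegral_exchange//.
have -> : \int[mu]_(t in `[a, b[) ((u t - \int[mu]_(s in `[a, t[) f s) * r t) =
    \int[mu]_(t in `[a, b[)
      (u t * r t + (r t * \int[mu]_(s in `[t, b[) f s - If * r t)).
  apply: eq_Rintegral => t; rewrite mem_setE in_itv /= => /andP[at_ tb].
  rewrite /If (@Rintegral_split_g f (BLeft a) (BLeft t) (BLeft b)) ?bnd_simp//.
    by ring.
  exact: ltW.
rewrite RintegralD//; last first.
  have := integrableB (mI _) intrf (intZ If _ intr).
  by apply: eq_integrable => // t _; rewrite /= EFinB.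
rewrite RintegralB ?RintegralZl//; last exact: intZ.
by ring.
Qed.

(** The error is an integral over []t, x[], whose mass [clamped g x - rc_version g t] tends to 0 as
    x decreases to t; absolute continuity of the integral concludes. *)
Lemma cvg_primitive_right r t : mu.-integrable `[a, b[ (EFin \o r) ->
  t \in `[a, b[ ->
  \int[mu]_(s in `[a, x[) r s @[x --> t^'+] --> \int[mu]_(s in `[a, t]) r s.
Proof.
move=> intr /[1!in_itv] /= /andP[at_ tb]; apply/cvgrPdist_lt => e e0.
have intr0 : mu.-integrable setT (EFin \o (r \_ (`[a, b[ : set T))).
  by rewrite -restrict_EFin; exact: (proj1 (integrable_mkcond _ (mI _)) intr).
have [delta [d0 H]] := integral_normr_continuous intr0 e0.
near=> x.
have tx : t < x by near: x; exact: nbhs_right_gt.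
have xb : x <= b by near: x; exact: nbhs_right_le.
have sub : `]t, x[ `<=` `[a, b[%classic.
  move=> y /=; rewrite !in_itv /= => /andP[ty yx].
  by rewrite (le_trans at_ (ltW ty)) (lt_le_trans yx xb).
have subx : `[a, x[ `<=` `[a, b[%classic by apply: subset_itvl; rewrite bnd_simp.
rewrite (@Rintegral_split_g r (BLeft a) (BRight t) (BLeft x)) ?bnd_simp//;
  last first.
  exact: integrable_sub_itv_g intr.
rewrite opprD addNKr normrN.
have intrx := integrable_sub_itv_g sub intr.
apply: le_lt_trans (le_normr_Rintegral (mI _) intrx) _.
have -> : \int[mu]_(s in `]t, x[) `|r s| =
    \int[mu]_(s in `]t, x[) `|(r \_ (`[a, b[ : set T)) s|.
  by apply: eq_Rintegral => s /set_mem sx; rewrite patchE mem_set//; exact: sub.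
apply: H => //; rewrite [X in (X < _)%E]mu_g_oo// lte_fin.
have : `|rc_version g t - clamped g x| < delta.
  by near: x; have /cvgrPdist_lt/(_ _ d0) := @rc_version_cvg _ _ _ g t.
by rewrite distrC ger0_norm// subr_ge0 rc_version_le.
Unshelve. all: by end_near. Qed.

Lemma Rintegral_set1_no_jump r t : mu.-integrable `[a, b[ (EFin \o r) ->
  t \in `[a, b[ -> ~ jump g t ->
  \int[mu]_(s in `[a, t]) r s = \int[mu]_(s in `[a, t[) r s.
Proof.
move=> intr tI nj; have := tI; rewrite in_itv /= => /andP[at_ tb].
have sub : `[a, t] `<=` `[a, b[%classic by apply: subset_itvl; rewrite bnd_simp.
rewrite (@Rintegral_split_g r (BLeft a) (BLeft t) (BRight t)) ?bnd_simp//;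
  last first.
  exact: integrable_sub_itv_g intr.
rewrite -[RHS]addr0; congr (_ + _).
(* [jump] uses the right limit of g itself, the measure that of the clamped g; they agree because t
   < b. *)
have GE : right_lim g t = rc_version g t.
  apply: cvg_lim; first exact: Rhausdorff.
  apply: cvg_trans (@rc_version_cvg _ _ _ g t); apply: near_eq_cvg; near=> x.
  rewrite clampedE//; last by near: x; exact: nbhs_right_le.
  by apply: le_trans at_ _; near: x; exact: nbhs_right_ge.
have Gg : rc_version g t = g t.
  apply/eqP; rewrite eq_le; apply/andP; split.
    by rewrite leNgt; apply/negP => gG; apply: nj; split=> //; rewrite GE subr_gt0.
  by rewrite -(@clampedE _ _ _ g t) ?(ltW tb)//; exact: rc_version_ge.
(* The mass of the point is that of [[t, b[] minus that of []t, b[], that is g(t+) - g(t) = 0. *)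
have m0 : mu `[t, t] = 0%E.
  have tb' := ltW tb.
  have := mu_g_itv g at_ tb' (lexx b).
  rewrite (@itv_bndbnd_setU _ R (BLeft t) (BRight t)) ?bnd_simp//.
  set A := `[t, t]%classic; set B := `]t, b[%classic.
  have -> : mu (A `|` B) = (mu A + mu B)%E.
    apply: measureU; [exact: mI|exact: mI|].
    rewrite /A /B -subset0 => x [] /=; rewrite !in_itv/=.
    by move=> /andP[_ xt] /andP[tx _]; have := le_lt_trans xt tx; rewrite ltxx.
  rewrite (mu_g_oo g tb) clampedE// ?(ltW ab)// Gg; case: (mu A) => //= x [] E.
  by congr EFin; lra.
rewrite /Rintegral null_set_integral//.
apply: (measurable_int mu); apply: integrable_sub_itv_g intr.
move=> x /=; rewrite !in_itv /= => /andP[tx xt].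
by rewrite (le_trans at_ tx) (le_lt_trans xt tb).
Unshelve. all: by end_near. Qed.

(** Each increment is the integral of f over [[l j, r j[], a set of mass g(r j) - g(l j), so the
    absolute continuity of the integral applies. *)
Lemma AC_g_primitive c f : mu.-integrable `[a, b[ (EFin \o f) ->
  AC_g g (k := RealField) (fun t => c + \int[mu]_(s in `[a, t[) f s).
Proof.
move=> intf e e0.
have intf0 : mu.-integrable setT (EFin \o (f \_ (`[a, b[ : set T))).
  by rewrite -restrict_EFin; exact: (proj1 (integrable_mkcond _ (mI _)) intf).
have [delta d0 H] := sum_Rintegral_norm_lt intf0 e0.
exists delta => // n l r lr tI gd.
have /H : (\sum_(j < n) mu `[l j, r j[ < delta%:E)%E.
  rewrite (eq_bigr (fun j => (g (r j) - g (l j))%:E)).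
    by rewrite sumEFin lte_fin.
  by move=> j _; have [al lr_ rb] := lr j; apply: mu_g_itv => //; exact: ltW.
move=> /(_ (fun=> mI _) tI); apply: le_lt_trans; rewrite /=; apply: ler_sum => j _.
have [al lr_ rb] := lr j.
have sub : `[l j, r j[ `<=` `[a, b[%classic.
  by apply: subset_itv; rewrite bnd_simp.
rewrite (@Rintegral_split_g f (BLeft a) (BLeft (l j)) (BLeft (r j))) ?bnd_simp//;
  last 2 first.
- exact: ltW.
- by apply: integrable_sub_itv_g intf; apply: subset_itvl; rewrite bnd_simp.
rewrite opprD addrACA subrr add0r addrC addKr.
apply: le_trans (le_normr_Rintegral (mI _) (integrable_sub_itv_g sub intf)) _.
rewrite le_eqVlt; apply/predU1P; left; apply: eq_Rintegral => s /set_mem sx.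
by rewrite patchE mem_set//; exact: sub.
Qed.

End primitives.

(** * Boundedness of [AC_g] functions and integrability of F(t, u(t)) *)

Section caratheodory.
Context {R : realType} {a b : R} (g : integrator a b).
Local Notation mu := (mu_g g).
Local Notation T := (mu_g_space g).

(* Induction on the levels of g: on a level of height delta the function U
   varies by at most 1. *)
Lemma AC_g_bounded (U : R -> R) : AC_g g (k := RealField) U ->
  exists B, forall t, t \in `[a, b] -> `|U t| <= B.
Proof.
move=> /(_ 1 ltr01)[delta d0 H].
(* The definition of [AC_g] with e = 1 and a single interval. *)
have close s t : s \in `[a, b] -> t \in `[a, b] -> s < t -> g t - g s < delta ->
    `|U t - U s| < 1.
  rewrite !in_itv /= => /andP[as_ _] /andP[_ tb] st gst.
  have := H 1%N (fun=> s) (fun=> t); rewrite !big_ord1; apply => //.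
  by apply/trivIsetP => i j _ _; rewrite (ord1 i) (ord1 j) eqxx.
have lev (n : nat) : exists B, forall t, t \in `[a, b] ->
    g t < g a + n%:R * delta -> `|U t| <= B.
  elim: n => [|n [B IH]].
    exists 0 => t; rewrite in_itv /= => /andP[at_ tb].
    by rewrite mul0r addr0 ltNge integrator_nd ?lexx.
  (* P describes the n-th level. If it is empty the earlier bound persists; otherwise any of its
     points t0 is a reference, since g varies by less than delta on the level. *)
  pose P t := [/\ t \in `[a, b], g a + n%:R * delta <= g t &
                  g t < g a + n.+1%:R * delta].
  have [[t0 [t0I t0n t0S]]|noP] := pselect (exists t, P t); last first.
    exists B => t tI tS; apply: IH => //; rewrite ltNge; apply/negP => tn.
    by apply: noP; exists t.
  exists (Num.max B (`|U t0| + 1)) => t tI tS; rewrite le_max.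
  have [/IH ->//|tn] := ltP (g t) (g a + n%:R * delta).
  apply/orP; right.
  rewrite -natr1 mulrDl mul1r in t0S tS.
  have : `|U t - U t0| <= 1.
    have [tt0|t0t|->] := ltgtP t t0; last by rewrite subrr normr0 ler01.
      by rewrite distrC ltW// close//; lra.
    by rewrite ltW// close//; lra.
  by have := ler_normD (U t - U t0) (U t0); rewrite subrK; lra.
(* Finitely many levels of height delta exhaust the range of g. *)
have [n gn] : exists n : nat, g b - g a < n%:R * delta.
  exists (Num.truncn ((g b - g a) / delta)).+1.
  by rewrite -ltr_pdivrMr// truncnS_gt.
have [B HB] := lev n; exists B => t tI; apply: HB => //.
have := tI; rewrite in_itv /= => /andP[at_ tb].
by have := integrator_nd g at_ tb (lexx b); lra.
Qed.

Section vectors.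
Context {d : nat}.
Implicit Types (F : R -> 'rV[R]_d -> 'rV[R]_d) (u : R -> 'rV[R]_d).

Lemma coord_le_enorm (x : 'rV[R]_d) i : `|x ord0 i| <= enorm x.
Proof.
rewrite -sqrtr_sqr ler_wsqrtr// (bigD1 i)//= lerDl.
by apply: sumr_ge0 => j _; exact: sqr_ge0.
Qed.

Lemma enorm_le_bounded (x : 'rV[R]_d) B : (forall i, `|x ord0 i| <= B) ->
  enorm x <= Num.sqrt (\sum_(i < d) B ^+ 2).
Proof.
move=> xB; rewrite ler_wsqrtr//; apply: ler_sum => i _.
by rewrite -real_normK ?num_real// ler_sqr ?nnegrE// (le_trans _ (xB i)).
Qed.

Lemma measurable_nemytskii F u i : caratheodory_lipschitz g F ->
  (forall j, measurable_fun (`[a, b[ : set T) (fun t => u t ord0 j)) ->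
  measurable_fun (`[a, b[ : set T) (fun t => F t (u t) ord0 i).
Proof.
move=> [mF cF _] mu_.
apply: (@measurable_fun_caratheodory _ _ _ mu _ d (fun t x => F t x ord0 i)).
- exact: mu_g_complete.
- exact: measurable_itv_g.
- by move=> x; have [] := mF x i.
- apply: filterS cF => t ct tI x.
  apply: (@continuous_comp _ _ _ (F t) (fun y : 'rV[R]_d => y ord0 i)).
    exact: ct.
  exact: coord_continuous.
- exact: mu_.
Qed.

(** Each coordinate of F(t, u) is dominated by m + C L. The bound on u matters: the product of L
    with a merely integrable u may fail to be integrable. *)
Lemma integrable_nemytskii F u i B : caratheodory_lipschitz g F ->
  (forall j, measurable_fun (`[a, b[ : set T) (fun t => u t ord0 j)) ->
  {ae mu, forall t, t \in `[a, b[ -> forall j, `|u t ord0 j| <= B} ->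
  mu.-integrable `[a, b[ (EFin \o (fun t => F t (u t) ord0 i)).
Proof.
move=> hF mu_ uB; have [_ _ [m [L [[im _] [iL _] mL0 Fm FL]]]] := hF.
(* C bounds the Euclidean norm of a vector whose coordinates are at most B in modulus. *)
pose C := Num.sqrt (\sum_(i < d) B ^+ 2).
have mab : measurable (`[a, b[ : set T) by exact: measurable_itv_g.
have ih : mu.-integrable `[a, b[ (EFin \o (fun t => m t + C * L t)).
  have iCL : mu.-integrable `[a, b[ (EFin \o (fun t => C * L t)).
    by have := @integrableZl _ _ _ mu _ mab C _ iL.
  by have := integrableD mab im iCL.
apply: ae_le_integrable ih _ => //; first exact: measurable_nemytskii.
apply: filterS3 uB Fm FL => t uB Fm FL tI.
have [m0 L0] := mL0 t tI.
apply: (le_trans _ (ler_norm _)).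
have -> : F t (u t) ord0 i = (F t (u t) - F t 0) ord0 i + F t 0 ord0 i.
  by rewrite !mxE subrK.
apply: le_trans (ler_normD _ _) _; rewrite addrC.
apply: lerD; first exact: le_trans (coord_le_enorm _ _) (Fm tI).
apply: le_trans (coord_le_enorm _ _) _.
apply: le_trans (FL tI _ _) _; rewrite mulrC subr0.
by apply: ler_wpM2r => //; apply: enorm_le_bounded; exact: uB.
Qed.

End vectors.
End caratheodory.

(** * Reduction of scalars to real and imaginary parts *)

Section scalar_parts.
Context {R : realType} {k : scalar_field}.
Local Notation K := (Defs.scalar R k).
Implicit Types (z w : K) (x : R).

(** A boolean selects the part, so that one real statement covers both; over the reals the imaginary
    part is 0. *)
Definition part (im : bool) z : R := if im then scalar_Im z else scalar_Re z.

Lemma part_inj z w : (forall im, part im z = part im w) -> z = w.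
Proof.
move=> H; have := (H false, H true); rewrite /part.
by case: k z w {H} => //= [z w [] //|[zr zi] [wr wi] [/= -> ->]].
Qed.

Lemma part_to_scalarE x y im :
  part im (to_scalar k x y) = if im then (if k is RealField then 0 else y) else x.
Proof. by rewrite /part; case: k; case: im. Qed.

Lemma partD im z w : part im (z + w) = part im z + part im w.
Proof.
rewrite /part; case: k z w => z w; first by case: im; rewrite ?addr0.
by case: z w => [zr zi] [wr wi]; case: im.
Qed.

Lemma partB im z w : part im (z - w) = part im z - part im w.
Proof.
rewrite /part; case: k z w => z w; first by case: im; rewrite ?subr0.
by case: z w => [zr zi] [wr wi]; case: im.
Qed.

Lemma partM im x z : part im (of_real k x * z) = x * part im z.
Proof.
rewrite /part /of_real; case: k z => z; first by case: im; rewrite /= ?mulr0.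
by case: z => [zr zi]; case: im; rewrite /= mul0r ?addr0 ?subr0.
Qed.

Lemma norm_of_real x : `|of_real k x| = of_real k `|x|.
Proof.
rewrite /of_real; case: k => //=; rewrite normc_def /=.
by rewrite expr0n addr0 sqrtr_sqr.
Qed.

Lemma le_of_real x y : (of_real k x <= of_real k y) = (x <= y).
Proof. by rewrite /of_real; case: k => //=; rewrite lecR. Qed.

Lemma norm_part_le im z M : `|z| <= of_real k M -> `|part im z| <= M.
Proof.
rewrite /part /of_real; case: k z => /= [|[x y]].
  by case: im => z //; rewrite normr0; exact: le_trans.
rewrite normc_def lecR /= => /(le_trans _); apply.
by case: im => /=; rewrite -sqrtr_sqr ler_wsqrtr// ?lerDl ?lerDr sqr_ge0.
Qed.

Lemma norm_le_part z : `|z| <= of_real k (`|part false z| + `|part true z|).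
Proof.
rewrite /part /of_real; case: k z => /= [z|[x y]]; first by rewrite normr0 addr0.
rewrite normc_def lecR /= -[leRHS]ger0_norm ?addr_ge0// -sqrtr_sqr ler_wsqrtr//.
by rewrite sqrrD !real_normK ?num_real// addrAC lerDl mulrn_wge0// mulr_ge0.
Qed.

(** In the partial order of the complex numbers a positive element is real, so every epsilon comes
    from R. *)
Lemma gt0_of_real z : 0 < z -> exists2 x : R, 0 < x & z = of_real k x.
Proof.
rewrite /of_real; case: k z => z /=; first by exists z.
by case: z => x y; rewrite ltcE /= => /andP[/eqP -> x0]; exists x.
Qed.

Lemma part_int_g (a b : R) (g : integrator a b) D f im :
  part im (int_g (k := k) g D f) = \int[mu_g g]_(t in D) part im (f t).
Proof.
rewrite /int_g part_to_scalarE /part; case: im => //.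
by case: k f => //= f; rewrite /Rintegral integral0.
Qed.

Lemma cvg_part (U : Type) (F : set_system U) (FF : Filter F) (f : U -> K) z :
  (forall im, part im (f x) @[x --> F] --> part im z) -> f x @[x --> F] --> z.
Proof.
move=> H; apply/cvgrPdist_le => e /gt0_of_real[x x0 ->].
have x2 : 0 < x / 2 by rewrite divr_gt0.
have /cvgrPdist_le/(_ _ x2) H1 := H false.
have /cvgrPdist_le/(_ _ x2) H2 := H true.
apply: filterS2 H1 H2 => t /= h1 h2.
apply: le_trans (norm_le_part _) _; rewrite le_of_real !partB.
by rewrite [x]splitr lerD.
Qed.

End scalar_parts.

(** * Test functions, their posterior traces and the weak identity part by part *)

Section test_functions.
Context {R : realType} {a b : R} (g : integrator a b) {k : scalar_field}.
Local Notation K := (Defs.scalar R k).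
Local Notation mu := (mu_g g).
Local Notation T := (mu_g_space g).
Hypothesis ab : a < b.
Implicit Types phi psi : R -> K.

Lemma Loo_g_part psi im : Loo_g g psi ->
  measurable_fun (`[a, b[ : set T) (fun t => part im (psi t)) /\
  exists M, {ae mu, forall t, t \in `[a, b[ -> `|part im (psi t)| <= M}.
Proof.
move=> [[mr mi] [M bM]]; split; first by case: im.
by exists M; apply: filterS bM => t bt /bt; exact: norm_part_le.
Qed.

Lemma Loo_g_of_real (r : R -> R) M : measurable_fun (`[a, b[ : set T) r ->
  (forall t, `|r t| <= M) -> Loo_g g (fun t => of_real k (r t)).
Proof.
move=> mr bM; split.
  rewrite /measurable_g /of_real; case: k => //=; split=> //.
  - exact: measurable_cst.
  - exact: measurable_cst.
by exists M; apply: aeW => t _; rewrite norm_of_real le_of_real.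
Qed.

Lemma posterior_trace_part phi psi c t im : Loo_g g psi ->
  (forall s, s \in `[a, b] -> phi s = c + int_g g `[a, s[ psi) ->
  t \in `[a, b[ ->
  part im (posterior_trace g phi t) =
  part im c + \int[mu]_(s in `[a, t]) part im (psi s).
Proof.
move=> psioo phiE tI; have := tI; rewrite in_itv /= => /andP[at_ tb].
have intp i : mu.-integrable `[a, b[ (EFin \o (fun s => part i (psi s))).
  have [mp [M bM]] := Loo_g_part i psioo.
  exact: (integrable_ae_bounded_g ab mp bM).
have phip i s : s \in `[a, b] ->
    part i (phi s) = part i c + \int[mu]_(x in `[a, s[) part i (psi x).
  by move=> sI; rewrite phiE// partD part_int_g.
rewrite /posterior_trace; case: asboolP => [_|nj]; last first.
  rewrite phip; last by rewrite in_itv /= at_ ltW.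
  by rewrite (Rintegral_set1_no_jump ab (intp im) tI nj).
(* At a jump, the right limit is identified in K by convergence of both parts. *)
pose l : K := c + int_g g `[a, t] psi.
have -> : right_lim phi t = l; last by rewrite partD part_int_g.
apply: cvg_lim; first exact: norm_hausdorff.
apply: cvg_part => i; rewrite partD part_int_g.
have : part i c + \int[mu]_(x in `[a, s[) part i (psi x) @[s --> t^'+] -->
    part i c + \int[mu]_(x in `[a, t]) part i (psi x).
  by apply: cvgD; [exact: cvg_cst|exact: (cvg_primitive_right (intp i) tI)].
(* The formula for phi holds on [[a, b]] only; as t < b, it covers all s slightly to the right of
   t. *)
apply: cvg_trans; apply: near_eq_cvg; near=> s; rewrite phip// in_itv /=.
apply/andP; split; last by near: s; exact: nbhs_right_le.
by apply: le_trans at_ _; near: s; exact: nbhs_right_ge.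
Unshelve. all: by end_near. Qed.

(** For a fixed test function, the identity in K splits into real identities free of the posterior
    trace; p is the corresponding part of phi(b). *)
Lemma weak_form_part (u f : R -> R) (u0 ub : R) phi psi c :
  mu.-integrable `[a, b[ (EFin \o u) -> mu.-integrable `[a, b[ (EFin \o f) ->
  Loo_g g psi ->
  (forall s, s \in `[a, b] -> phi s = c + int_g g `[a, s[ psi) ->
  int_g g `[a, b[ (fun t => of_real k (u t) * psi t) +
  int_g g `[a, b[ (fun t => of_real k (f t) * posterior_trace g phi t) =
  of_real k ub * phi b - of_real k u0 * phi a <->
  forall im, let p := part im c + \int[mu]_(t in `[a, b[) part im (psi t) in
    \int[mu]_(t in `[a, b[)
      ((u t - \int[mu]_(s in `[a, t[) f s) * part im (psi t)) +
    (\int[mu]_(t in `[a, b[) f t) * p = ub * p - u0 * part im c.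
Proof.
move=> intu intf psioo phiE.
have phib im : part im (phi b) = part im c + \int[mu]_(t in `[a, b[) part im (psi t).
  by rewrite phiE ?partD ?part_int_g// in_itv /= lexx (ltW ab).
have phia im : part im (phi a) = part im c.
  rewrite phiE ?partD ?part_int_g; last by rewrite in_itv /= lexx (ltW ab).
  by rewrite set_itvxx Rintegral_set0 addr0.
have lhs im : part im (int_g g `[a, b[ (fun t => of_real k (u t) * psi t) +
  int_g g `[a, b[ (fun t => of_real k (f t) * posterior_trace g phi t)) =
    \int[mu]_(t in `[a, b[)
      ((u t - \int[mu]_(s in `[a, t[) f s) * part im (psi t)) +
    (\int[mu]_(t in `[a, b[) f t) *
      (part im c + \int[mu]_(t in `[a, b[) part im (psi t)).
  rewrite partD !part_int_g.
  have [mp [M bM]] := Loo_g_part im psioo.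
  rewrite -(weak_form_identity ab (part im c) intu intf mp bM).
  congr (_ + _); apply: eq_Rintegral => t; first by rewrite partM.
  by rewrite mem_setE => tI; rewrite partM (posterior_trace_part _ psioo phiE).
split=> [E im|E]; first by rewrite /= -lhs E partB !partM phib phia.
by apply: part_inj => im; rewrite lhs E partB !partM phib phia.
Qed.

End test_functions.

(** * Weak identity and integral equation for one component *)

Section weak_scalar.
Context {R : realType} {a b : R} (g : integrator a b) (k : scalar_field).
Local Notation K := (Defs.scalar R k).
Local Notation mu := (mu_g g).
Local Notation T := (mu_g_space g).
Hypothesis ab : a < b.

Lemma weak_form_primitive (u f : R -> R) (u0 ub : R) :
  mu.-integrable `[a, b[ (EFin \o u) -> mu.-integrable `[a, b[ (EFin \o f) ->
  (forall phi psi : R -> K, test_function g phi psi ->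
    int_g g `[a, b[ (fun t => of_real k (u t) * psi t) +
    int_g g `[a, b[ (fun t => of_real k (f t) * posterior_trace g phi t) =
    of_real k ub * phi b - of_real k u0 * phi a) <->
  {ae mu, forall t, t \in `[a, b[ -> u0 + \int[mu]_(s in `[a, t[) f s = u t} /\
  u0 + \int[mu]_(s in `[a, b[) f s = ub.
Proof.
move=> intu intf.
have mab : measurable (`[a, b[ : set T) by exact: measurable_itv_g.
set V := fun t => \int[mu]_(s in `[a, t[) f s.
have intV : mu.-integrable `[a, b[ (EFin \o V) by exact: integrable_primitive.
have intc := integrable_cst_g g ab.
split=> [W|[uE ubE] phi psi [psioo [c phiE]]]; last first.
  apply: (proj2 (weak_form_part ab u0 ub intu intf psioo phiE)) => im p.
  rewrite -ubE.
  have [mp [M bM]] := Loo_g_part im psioo.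
  (* By hypothesis u - V = u0 almost everywhere. *)
  have -> : \int[mu]_(t in `[a, b[) ((u t - V t) * part im (psi t)) =
      \int[mu]_(t in `[a, b[) (u0 * part im (psi t)).
    congr fine; apply: ae_eq_integral => //.
    - apply/measurable_EFinP/measurable_funM => //; apply/measurable_EFinP.
      exact: (measurable_int mu (integrableB mab intu intV)).
    - by apply/measurable_EFinP/measurable_funM.
    by apply: filterS uE => t ut tI; rewrite -ut// addrK.
  rewrite RintegralZl//; last exact: (integrable_ae_bounded_g ab mp bM).
  by rewrite /p; ring.
(* For this implication real-valued derivatives r and real constants c suffice; the real part of the
   identity is kept. *)
have W' (r : R -> R) (c M : R) : measurable_fun (`[a, b[ : set T) r ->
    (forall t, `|r t| <= M) -> let p := c + \int[mu]_(t in `[a, b[) r t in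
    \int[mu]_(t in `[a, b[) ((u t - V t) * r t) +
      (\int[mu]_(t in `[a, b[) f t) * p = ub * p - u0 * c.
  move=> mr rM; have roo := Loo_g_of_real (k := k) mr rM.
  pose psi t : K := of_real k (r t); pose phi t := of_real k c + int_g g `[a, t[ psi.
  have tphi : test_function g phi psi by split=> //; exists (of_real k c).
  have /(proj1 (weak_form_part ab u0 ub intu intf roo (fun _ _ => erefl))) :=
    W _ _ tphi.
  move=> /(_ false); rewrite /psi.
  by rewrite /part /of_real; case: k.
(* The test function phi = 1, that is r = 0 and c = 1, gives the end value. *)
have I : u0 + \int[mu]_(s in `[a, b[) f s = ub.
  have m0 : measurable_fun (`[a, b[ : set T) (fun=> 0 : R) by exact: measurable_cst.
  have := W' (fun=> 0) 1 0 m0; rewrite normr0 lexx => /(_ (fun=> isT)) /=.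
  have -> : \int[mu]_(t in `[a, b[) ((u t - V t) * 0) = 0.
    rewrite (_ : (fun t => _) = (fun=> 0)) ?Rintegral_cst ?mul0r//.
    by apply/funext => t; rewrite mulr0.
  rewrite Rintegral_cst// mul0r add0r addr0 !mulr1 => ->.
  by ring.
split=> //.
pose w t := u t - V t - u0.
have intw : mu.-integrable `[a, b[ (EFin \o w).
  exact: (integrableB mab (integrableB mab intu intV) (intc u0)).
have mw : measurable_fun (`[a, b[ : set T) w.
  by apply/measurable_EFinP; exact: measurable_int intw.
(* The sign of w, with value 1 where w vanishes; it satisfies w sgw = |w| and is bounded by 1. *)
pose sgw t : R := if 0 <= w t then 1 else -1.
have msg : measurable_fun (`[a, b[ : set T) sgw.
  exact: measurable_fun_sgn.
have sg1 t : `|sgw t| <= 1.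
  by rewrite /sgw; case: ifP; rewrite ?normrN normr1.
have sg1_ae : {ae mu, forall t, t \in `[a, b[ -> `|sgw t| <= 1}.
  by apply: aeW => t _.
have := W' _ 0 1 msg sg1.
set J := \int[mu]_(t in `[a, b[) sgw t.
(* With c = 0 the identity has V(b) J on the left and (u0 + V(b)) J on the right; cancelling V(b) J
   leaves u0 J as the integral of (u - V) sgw. *)
rewrite /= add0r mulr0 subr0 -I mulrDl => /addIr E.
have E0 : \int[mu]_(t in `[a, b[) `|w t| = 0.
  have intsg : mu.-integrable `[a, b[ (EFin \o sgw).
    exact: (integrable_ae_bounded_g ab msg sg1_ae).
  have -> : \int[mu]_(t in `[a, b[) `|w t| =
    \int[mu]_(t in `[a, b[) ((u t - V t) * sgw t - u0 * sgw t).
    apply: eq_Rintegral => t _; rewrite -mulrBl -/(w t) /sgw.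
    by case: leP => w0; [rewrite mulr1 ger0_norm|rewrite mulrN1 ltr0_norm].
  have intsu := integrableM_ae_bounded mab (integrableB mab intu intV) msg sg1_ae.
  have intsc := integrableM_ae_bounded mab (intc u0) msg sg1_ae.
  by rewrite RintegralB// RintegralZl// E subrr.
have A0 : (\int[mu]_(t in `[a, b[) `|(w t)%:E| = 0)%E.
  have := integrable_fin_num mab (integrable_norm intw) => /fineK <-.
  exact: (congr1 EFin E0).
have := proj1 (ae_eq_integral_abs mu mab (measurable_int mu intw)) A0.
apply: filterS => t wt tI.
have [] := wt tI; rewrite /w => /eqP.
by rewrite subr_eq0 subr_eq => /eqP ->.
Qed.

End weak_scalar.

(** * From components to systems *)

Theorem theorem6p3 (R : realType) (k : scalar_field) (a b : R) (ab : a < b)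
    (d : nat) (g : integrator a b) (Mg_gt0 : (0 < mu_g g `[a, b[)%E)
    (F : R -> 'rV[R]_d -> 'rV[R]_d) (hF : caratheodory_lipschitz g F)
    (u : R -> 'rV[R]_d) (hu : vL1_g g u) (u0 ub : 'rV[R]_d) :
  global_weak_solution g k F u u0 ub <->
  exists U : R -> 'rV[R]_d,
    [/\ vAC_g g U,
        {ae mu_g g, forall t, t \in `[a, b[ -> U t = u t},
        forall t, t \in `[a, b] ->
          U t = u0 + vint_g g `[a, t[ (fun s => F s (U s)) &
        U b = ub].
Proof.
have mu_ i : measurable_fun (`[a, b[ : set (mu_g_space g)) (fun t => u t ord0 i).
  by apply/measurable_EFinP; exact: measurable_int (hu i).1.
(* The integral equation involves F along U, the weak form F along u; their primitives coincide on
   [[a, b]]. *)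
have eq_vint U : {ae mu_g g, forall t, t \in `[a, b[ -> U t = u t} ->
    vL1_g g (fun t => F t (u t)) -> forall t, t <= b ->
    vint_g g `[a, t[ (fun s => F s (U s)) = vint_g g `[a, t[ (fun s => F s (u s)).
  move=> Uu intF t tb; apply/rowP => i; rewrite !mxE.
  have sub : `[a, t[ `<=` `[a, b[%classic by apply: subset_itvl; rewrite bnd_simp.
  apply/esym/ae_eq_Rintegral.
  - exact: mu_g_complete.
  - exact: measurable_itv_g.
  - apply/measurable_EFinP; apply: (measurable_int (mu_g g)).
    exact: integrable_sub_itv_g sub (intF i).1.
  by apply: filterS Uu => s Us sI; rewrite Us//; exact: sub.
split=> [[_ intF W]|[U [acU Uu UE Ub]]].
- have W' i := proj1 (weak_form_primitive k ab (u0 ord0 i) (ub ord0 i)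
    (hu i).1 (intF i).1) (fun phi psi test => W phi psi test i).
  (* The representative is defined by integrating F along the given u, which avoids circularity; it
     solves the equation once U = u almost everywhere is known. *)
  pose U t := u0 + vint_g g `[a, t[ (fun s => F s (u s)).
  have Uu : {ae mu_g g, forall t, t \in `[a, b[ -> U t = u t}.
    have : {ae mu_g g, forall t, forall i, t \in `[a, b[ -> U t ord0 i = u t ord0 i}.
      apply: filter_forall => i; have [+ _] := W' i.
      by apply: filterS => t ut /ut; rewrite !mxE.
    by apply: filterS => t Ut tI; apply/rowP => i; exact: Ut.
  exists U; split=> //.
  + move=> i; rewrite (_ : (fun t => _) = fun t => u0 ord0 i +
      \int[mu_g g]_(s in `[a, t[) F s (u s) ord0 i).
      exact: AC_g_primitive (intF i).1.
    by apply/funext => t; rewrite !mxE.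
  + move=> t; rewrite in_itv /= => /andP[_ tb]; congr (_ + _).
    by apply/esym/eq_vint.
  + by apply/rowP => i; have [_ <-] := W' i; rewrite !mxE.
(* Integrability of F(., u) is part of being a weak solution; it follows from the boundedness of the
   components of U. *)
have intF : vL1_g g (fun t => F t (u t)).
  have [B UB] := choice (fun i => AC_g_bounded (acU i)).
  (* The imaginary part of a real component is the constant 0. *)
  move=> i; split; last exact: integrable_cst_g.
  (* The sum of the [|B j|] bounds all coordinates of u simultaneously, almost everywhere. *)
  apply: (@integrable_nemytskii _ _ _ _ _ _ _ _ (\sum_(j < d) `|B j|)) => //.
  apply: filterS Uu => t Ut tI j; rewrite -Ut//.
  have tI' : t \in `[a, b].
    by move: tI; rewrite !in_itv /= => /andP[-> /ltW].
  apply: le_trans (UB j t tI') _; rewrite (bigD1 j)//=.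
  by apply: (le_trans (ler_norm _)); rewrite lerDl sumr_ge0.
split=> // phi psi test i; move: phi psi test.
apply: (proj2 (weak_form_primitive k ab _ _ (hu i).1 (intF i).1)); split.
  apply: (filterS _ Uu) => t Ut tI /=; rewrite -Ut// UE; last first.
    by move: tI; rewrite !in_itv /= => /andP[-> /ltW].
  rewrite (eq_vint _ Uu intF) ?mxE//.
  by move: tI; rewrite in_itv /= => /andP[_ /ltW].
rewrite -Ub UE; last by rewrite in_itv /= lexx (ltW ab).
by rewrite (eq_vint _ Uu intF)// !mxE.
Qed.
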